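(* Let $X$, $Y$ be graphs and let $\varphi:X\rightarrow Y$ be a complete orbit homomorphism. For $1\leq i\leq c(Y)$, let $y_i\in V_Y$ be such that $\mathcal{C}(Y)=\{C_Y(y_i):1\leq i\leq c(Y)\}$ and let $C_i\in\mathcal{C}(X)_{y_i}$. Then $$c(X)=\sum_{i=1}^{c(Y)}\frac{k_X(y_i)}{k_{C_i}(y_i)}.$$
   Context: All graphs are finite, undirected, simple and reflexive: a graph $X=(V_X,E_X)$ has a finite nonempty vertex set $V_X$, and $E_X$ consists of all loops $\{x\}$ ($x\in V_X$) together with a (possibly empty) set of $2$-element subsets of $V_X$. A homomorphism $\varphi:X\to Y$ is a map $\varphi:V_X\to V_Y$ such that $\{x_1,x_2\}\in E_X$ implies $\{\varphi(x_1),\varphi(x_2)\}\in E_Y$ (a proper edge may be mapped to a loop). It is complete if $\varphi(V_X)=V_Y$ and $\varphi(E_X)=E_Y$. It is an orbit homomorphism if there is a subgroup $\mathfrak{G}\leq\mathrm{Aut}(X)$ of graph automorphisms of $X$ such that the nonempty fibres $\varphi^{-1}(y)$ are exactly the orbits of $\mathfrak{G}$ on $V_X$. A component of a graph is a maximal connected subgraph; $C_Y(y)$ is the component of $Y$ containing $y$, $\mathcal{C}(X)$ is the set of components of $X$, $c(X)=|\mathcal{C}(X)|$. For $y\in V_Y$ and a subgraph $\hat X$ of $X$, $k_{\hat X}(y)=|V_{\hat X}\cap\varphi^{-1}(y)|$ (so $k_X(y)=|\varphi^{-1}(y)|$), and $\mathcal{C}(X)_y=\{C\in\mathcal{C}(X):k_C(y)>0\}$.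 *)

(* Defs.v *)
From mathcomp Require Import all_boot all_order all_fingroup all_algebra.

Set Implicit Arguments.
Unset Strict Implicit.
Unset Printing Implicit Defensive.

(* Finite, undirected, simple, reflexive graphs on a nonempty vertex set. An
   edge is its set of endpoints: a loop is a singleton, a proper edge has two
   elements. *)
Record graph := Graph {
  vertex :> finType;
  edges : {set {set vertex}};
  vertex_gt0 : 0 < #|vertex|;
  loop_edge : forall x : vertex, [set x] \in edges;
  card_edge : forall e : {set vertex}, e \in edges -> #|e| = 1 \/ #|e| = 2
}.

(* Candidate subgraphs (vertex set, edge set). *)
Notation subgraph X := ({set vertex X} * {set {set vertex X}})%type.

Definition full_subgraph (X : graph) : subgraph X := ([set: X], edges X).

(* Subgraphs are themselves graphs: nonempty, and carrying all their loops. *)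
Definition is_subgraph (X : graph) (H : subgraph X) : bool :=
  [&& H.1 != set0,
      H.2 \subset edges X,
      [forall e in H.2, e \subset H.1] &
      [forall x in H.1, [set x] \in H.2]].

Definition subgraph_le (X : graph) (H K : subgraph X) : bool :=
  (H.1 \subset K.1) && (H.2 \subset K.2).

Definition sub_adj (X : graph) (H : subgraph X) : rel X :=
  [rel x y | [set x; y] \in H.2].

Definition connected_subgraph (X : graph) (H : subgraph X) : bool :=
  is_subgraph H && [forall x in H.1, forall y in H.1, connect (sub_adj H) x y].

Definition is_component (X : graph) (C : subgraph X) : bool :=
  connected_subgraph C &&
  [forall K : subgraph X,
     connected_subgraph K ==> subgraph_le C K ==> (K == C)].

Definition components (X : graph) : {set subgraph X} :=
  [set C | is_component C].

Definition ncomponents (X : graph) : nat := #|components X|.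

(* The default is never used: see component_ofP and component_of_uniq. *)
Definition component_of (X : graph) (x : X) : subgraph X :=
  odflt (full_subgraph X) [pick C in components X | x \in C.1].

Definition homomorphism (X Y : graph) (f : X -> Y) : Prop :=
  forall x1 x2 : X,
    [set x1; x2] \in edges X -> [set f x1; f x2] \in edges Y.

Definition complete_hom (X Y : graph) (f : X -> Y) : Prop :=
  [/\ homomorphism f,
      f @: [set: X] = [set: Y] &
      [set f @: e | e : {set X} in edges X] = edges Y].

Definition graph_aut (X : graph) : {set {perm X}} :=
  [set s : {perm X} |
    [forall x, forall y,
       ([set s x; s y] \in edges X) == ([set x; y] \in edges X)]].

Definition fibre (X Y : graph) (f : X -> Y) (y : Y) : {set X} :=
  [set x | f x == y].

Definition orbit_hom (X Y : graph) (f : X -> Y) : Prop :=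
  homomorphism f /\
  exists G : {group {perm X}},
    G \subset graph_aut X /\
    [set fibre f y | y : Y & fibre f y != set0]
      = [set orbit 'P%act G x | x : X].

Definition fibre_count (X Y : graph) (f : X -> Y) (H : subgraph X) (y : Y)
    : nat :=
  #|H.1 :&: fibre f y|.

Definition components_over (X Y : graph) (f : X -> Y) (y : Y)
    : {set subgraph X} :=
  [set C in components X | 0 < fibre_count f C y].

Section ComponentOf.
Variable X : graph.
Implicit Types (x y : X) (H K C : subgraph X).

Lemma sub_adj_sym H : symmetric (sub_adj H).
Proof. by move=> x y; rewrite /sub_adj /= setUC. Qed.

Lemma exists_component H :
  connected_subgraph H -> exists2 C, is_component C & subgraph_le H C.
Proof.
move=> cH; pose P K := connected_subgraph K && subgraph_le H K.
have PH : P H by rewrite /P cH /subgraph_le !subxx.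
case: (arg_maxnP (fun K => #|K.1| + #|K.2|) PH) => C /andP[cC leHC] maxC.
exists C => //; rewrite /is_component cC /=.
apply/forallP => K; apply/implyP => cK; apply/implyP => leCK.
case/andP: (leCK) => s1 s2; case/andP: (leHC) => t1 t2.
have PK : P K by rewrite /P cK /subgraph_le (subset_trans t1) ?(subset_trans t2).
have := maxC K PK; have l1 := subset_leq_card s1; have l2 := subset_leq_card s2.
move=> /= le.
have e1 : #|K.1| <= #|C.1|.
  by rewrite -(leq_add2r #|C.2|) (leq_trans _ le) // leq_add2l.
have e2 : #|K.2| <= #|C.2|.
  by rewrite -(leq_add2l #|C.1|) (leq_trans _ le) // leq_add2r.
have /eqP f1 : C.1 == K.1 by rewrite eqEcard s1 e1.
have /eqP f2 : C.2 == K.2 by rewrite eqEcard s2 e2.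
by case: K C f1 f2 {s1 s2 leCK PK cK l1 l2 le e1 e2 cC leHC maxC t1 t2}
  => [K1 K2] [C1 C2] /= -> ->.
Qed.

Lemma connected_point x : connected_subgraph ([set x], [set [set x]]).
Proof.
apply/andP; split; last first.
  apply/forall_inP => a /set1P->; apply/forall_inP => b /set1P->.
  exact: connect0.
apply/and4P; split => /=.
- by apply/set0Pn; exists x; rewrite set11.
- by rewrite sub1set loop_edge.
- by apply/forall_inP => e /set1P->.
- by apply/forall_inP => a /set1P->; rewrite set11.
Qed.

Lemma connected_union x H K :
  connected_subgraph H -> connected_subgraph K -> x \in H.1 -> x \in K.1 ->
  connected_subgraph (H.1 :|: K.1, H.2 :|: K.2).
Proof.
move=> /andP[/and4P[_ sH /forall_inP iH /forall_inP lH] /forall_inP cH].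
move=> /andP[/and4P[_ sK /forall_inP iK /forall_inP lK] /forall_inP cK] xH xK.
set U := (_ :|: _, _).
have mon (L : subgraph X) : L.2 \subset U.2 -> subrel (connect (sub_adj L)) (connect (sub_adj U)).
  move=> sub; apply: connect_sub => a b ab; apply: connect1.
  exact: (subsetP sub).
have toU a : a \in U.1 -> connect (sub_adj U) x a.
  case/setUP => h.
    apply: (mon H); first exact: subsetUl.
    by move/forall_inP: (cH _ xH); apply.
  apply: (mon K); first exact: subsetUr.
  by move/forall_inP: (cK _ xK); apply.
apply/andP; split; last first.
  apply/forall_inP => a aU; apply/forall_inP => b bU.
  apply: connect_trans (toU _ bU).
  by rewrite (sym_connect_sym (@sub_adj_sym U)) toU.
apply/and4P; split => /=.
- by apply/set0Pn; exists x; rewrite inE xH.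
- by rewrite subUset sH.
- apply/forall_inP => e /setUP[/iH|/iK] h; apply: (subset_trans h).
    exact: subsetUl.
  exact: subsetUr.
- by apply/forall_inP => a /setUP[/lH|/lK] h; rewrite inE h ?orbT.
Qed.

Lemma component_of_uniq x C D :
  C \in components X -> D \in components X -> x \in C.1 -> x \in D.1 -> C = D.
Proof.
rewrite !inE => /andP[cC /forallP mC] /andP[cD /forallP mD] xC xD.
have cU := connected_union cC cD xC xD.
have /eqP <- := implyP (implyP (mC _) cU) (introT andP (conj (subsetUl _ _) (subsetUl _ _))).
by have /eqP := implyP (implyP (mD _) cU) (introT andP (conj (subsetUr _ _) (subsetUr _ _))).
Qed.

Lemma component_ofP x :
  component_of x \in components X /\ x \in (component_of x).1.
Proof.
rewrite /component_of; case: pickP => [C /andP[] //|none].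
have [C cC /andP[sC _]] := exists_component (connected_point x).
by have := none C; rewrite !inE cC (subsetP sC) ?set11.
Qed.

End ComponentOf.

(* Main.v *)
(* Edges of [Y] lift along [phi] with any prescribed starting point: some edge
   lies over it by completeness, and the group moves that edge to the given
   point. So every component of [X] meeting the fibres over a component of [Y]
   meets all of them. The group permutes transitively the components meeting a
   given fibre, so these cut the fibre into pieces of the same size. *)
Require Import Defs.
From mathcomp Require Import all_boot all_order all_fingroup all_algebra.

Set Implicit Arguments.
Unset Strict Implicit.
Unset Printing Implicit Defensive.

Local Notation adj X := (sub_adj (full_subgraph X)).

(** * Components as connectivity classes of vertices *)

Lemma component_of_eq (X : graph) (C : subgraph X) (x : X) :
  C \in components X -> x \in C.1 -> component_of x = C.
Proof.
move=> CX xC; have [DX xD] := component_ofP x.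
exact: component_of_uniq DX CX xD xC.
Qed.

Lemma component_inhabited (X : graph) (C : subgraph X) :
  C \in components X -> exists x, x \in C.1.
Proof.
by rewrite inE => /andP[/andP[/and4P[/set0Pn[x xC] _ _ _] _] _]; exists x.
Qed.

(** An edge with its endpoints and their loops is a connected subgraph, so some component contains
    all of it. *)
Lemma component_of_adj (X : graph) (x z : X) :
  adj X x z -> component_of x = component_of z.
Proof.
move=> xz; pose H : subgraph X := ([set x; z], [set [set x; z]; [set x]; [set z]]).
have Hadj : connect (sub_adj H) x z.
  by apply: connect1; rewrite /sub_adj /= !inE eqxx.
have cH : connected_subgraph H.
  apply/andP; split.
    apply/and4P; split => /=.
    - by apply/set0Pn; exists x; rewrite !inE eqxx.
    - by rewrite !subUset !sub1set !loop_edge !andbT; exact: xz.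
    - apply/forall_inP => e; rewrite !inE -orbA => /or3P[] /eqP->.
      + exact: subxx.
      + by rewrite sub1set !inE eqxx.
      + by rewrite sub1set !inE eqxx orbT.
    - by apply/forall_inP => a; rewrite !inE => /orP[] /eqP->; rewrite eqxx ?orbT.
  apply/forall_inP => a /set2P[]->; apply/forall_inP => b /set2P[]-> //.
  by rewrite (sym_connect_sym (@sub_adj_sym _ H)).
have [C cC /andP[/subsetP sC _]] := exists_component cH.
have CX : C \in components X by rewrite inE.
by rewrite !(component_of_eq CX) ?sC // !inE eqxx ?orbT.
Qed.

(** Replaces maximality of subgraphs by paths in the whole graph, so that later arguments go by
    induction on a path. *)
Lemma component_of_connect (X : graph) (x z : X) :
  connect (adj X) x z <-> component_of x = component_of z.
Proof.
split=> [/connectP[p] | eC].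
  elim: p x => [|a p IHp] x /=; first by move=> _ ->.
  by case/andP=> /component_of_adj -> /IHp.
have [CX xC] := component_ofP x; have [_ zC] := component_ofP z.
rewrite -eC in zC; move: CX; rewrite inE => /andP[/andP[/and4P[_ sE _ _]]].
move=> /forall_inP/(_ x xC)/forall_inP/(_ z zC) + _.
apply: connect_sub => a b ab; apply: connect1; exact: (subsetP sE).
Qed.

Lemma mem_component (X : graph) (x z : X) :
  (z \in (component_of x).1) = (component_of z == component_of x).
Proof.
have [CX _] := component_ofP x; apply/idP/eqP => [|<-].
  exact: component_of_eq.
exact: (component_ofP z).2.
Qed.

(** * Fibres as orbits, and lifting of edges and paths *)

Lemma orbit_hom_fibres (X Y : graph) (f : X -> Y) : orbit_hom f ->
  exists2 G : {group {perm X}}, G \subset graph_aut X &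
    forall x z, (z \in orbit 'P%act G x) = (f z == f x).
Proof.
case=> _ [G [sG eF]]; exists G => // x z.
(* The fibre through [x] is nonempty, hence one of the orbits, and so the orbit of each of its
   points. *)
have : fibre f (f x) \in [set orbit 'P%act G x | x : X].
  rewrite -eF; apply/imsetP; exists (f x); rewrite ?inE //.
  by apply/set0Pn; exists x; rewrite inE.
case/imsetP => a _ eO.
have /orbit_eqP -> : x \in orbit 'P%act G a by rewrite -eO inE.
by rewrite -eO inE.
Qed.

Lemma component_of_aut (X : graph) (s : {perm X}) (x z : X) :
  s \in graph_aut X -> component_of x = component_of z ->
  component_of (s x) = component_of (s z).
Proof.
rewrite inE => /forallP sA /component_of_connect/connectP[p].
elim: p x => [|a p IHp] x /=; first by move=> _ ->.
case/andP=> xa /IHp/[apply] <-; apply: component_of_adj.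
by rewrite /sub_adj /=; have /forallP/(_ a)/eqP -> := sA x.
Qed.

Lemma component_of_hom (X Y : graph) (f : X -> Y) (x z : X) :
  homomorphism f -> component_of x = component_of z ->
  component_of (f x) = component_of (f z).
Proof.
move=> hf /component_of_connect/connectP[p].
elim: p x => [|a p IHp] x /=; first by move=> _ ->.
by case/andP=> xa /IHp/[apply] <-; apply: component_of_adj; apply: hf.
Qed.

Lemma lift_adj (X Y : graph) (f : X -> Y) (x : X) (y : Y) :
  complete_hom f -> orbit_hom f -> adj Y (f x) y ->
  exists2 z, adj X x z & f z = y.
Proof.
move=> [_ _ eE] /orbit_hom_fibres[G /subsetP sG orbG].
rewrite {1}/sub_adj /= -eE => /imsetP[e eX exy].
(* Edges are bare sets, so the endpoints of [e] must be matched with [f x] and [y]. If the chosen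
   preimages coincide, then [y = f x], and [e] is either a loop or a proper edge collapsed by
   [f]. *)
have [a [b [eab fa fb]]] : exists a b, [/\ e = [set a; b], f a = f x & f b = y].
  have : f x \in f @: e by rewrite -exy !inE eqxx.
  case/imsetP=> a ae fa.
  have : y \in f @: e by rewrite -exy !inE eqxx orbT.
  case/imsetP=> b be fb; have [ab|ab] := eqVneq a b; last first.
    exists a, b; split=> //; apply/esym/eqP.
    rewrite eqEcard subUset !sub1set ae be cards2 ab /=.
    by case: (card_edge eX) => ->.
  have yx : y = f x by rewrite fb fa ab.
  have [e1|e2] := card_edge eX.
    exists a, a; split=> //; last by rewrite yx.
    move/eqP/cards1P: e1 => [c ec]; move: ae; rewrite ec => /set1P ->.
    by rewrite setUid.
  have /cards2P[c [d [cd ecd]]] : #|e| == 2 by rewrite e2.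
  have fe u : u \in e -> f u = f x.
    by move=> ue; have := imset_f f ue; rewrite -exy yx setUid => /set1P.
  exists c, d; rewrite yx; split=> //; apply: fe.
    by rewrite ecd !inE eqxx.
  by rewrite ecd !inE eqxx orbT.
(* Some [s] in the group sends [a] to [x]; then [s b] is adjacent to [x] and stays in the fibre of
   [b]. *)
have : x \in orbit 'P%act G a by rewrite orbG fa.
case/imsetP=> s Gs /= xs; have := sG s Gs; rewrite inE => /forallP/(_ a)/forallP/(_ b)/eqP.
rewrite -eab eX => sab; exists (s b); first by rewrite /sub_adj /= xs.
rewrite -fb; apply/eqP; rewrite -orbG.
by apply/imsetP; exists s.
Qed.

(** Homomorphisms preserve connectivity; conversely, a path from [f x] to [y] lifts edge by edge to
    a path starting at [x]. *)
Lemma mem_components_over (X Y : graph) (f : X -> Y) (x : X) (y : Y) :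
  complete_hom f -> orbit_hom f ->
  (component_of x \in components_over f y) = (component_of y == component_of (f x)).
Proof.
move=> cf of_; have [CX _] := component_ofP x; have [hf _ _] := cf.
rewrite inE CX /= card_gt0; apply/set0Pn/eqP => [[z]|eC].
  rewrite !inE mem_component => /andP[/eqP eC /eqP <-].
  exact: component_of_hom.
have [z eC' <-] : exists2 z, component_of z = component_of x & f z = y.
  move/esym/component_of_connect/connectP: eC => [p].
  elim: p x {CX} => [|b p IHp] x /=; first by move=> _ ->; exists x.
  case/andP=> /(lift_adj cf of_)[a xa <-] /IHp/[apply] -[z ez fz].
  by exists z; rewrite // (component_of_adj xa).
by exists z; rewrite !inE mem_component eC' !eqxx.
Qed.

(** * Counting fibres and components *)

Lemma fibre_count_le (X Y : graph) (f : X -> Y) (y : Y) (C D : subgraph X) :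
  orbit_hom f -> C \in components_over f y -> D \in components_over f y ->
  fibre_count f C y <= fibre_count f D y.
Proof.
move=> /orbit_hom_fibres[G /subsetP sG orbG].
rewrite !(inE, card_gt0) => /andP[CX /set0Pn[x]] + /andP[DX /set0Pn[z]].
rewrite !inE => /andP[xC /eqP fx] /andP[zD /eqP fz].
have eC : component_of x = C by apply: component_of_eq; rewrite ?inE.
have eD : component_of z = D by apply: component_of_eq; rewrite ?inE.
(* An automorphism from the group taking [x] to [z] maps [C] into [D] and preserves fibres, so it
   injects one intersection into the other. *)
have : z \in orbit 'P%act G x by rewrite orbG fx fz.
case/imsetP=> s Gs /= zs; rewrite /fibre_count -(card_imset _ (@perm_inj _ s)).
apply/subset_leq_card/subsetP => _ /imsetP[a + ->].
rewrite !inE -eC -eD !mem_component => /andP[/eqP eCa /eqP <-].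
rewrite zs; apply/andP; split; first by apply/eqP/component_of_aut/eCa/sG.
by rewrite -orbG; apply/imsetP; exists s.
Qed.

Lemma fibre_count_full (X Y : graph) (f : X -> Y) (y : Y) (C : subgraph X) :
  orbit_hom f -> C \in components_over f y ->
  fibre_count f (full_subgraph X) y = #|components_over f y| * fibre_count f C y.
Proof.
move=> of_ CY; rewrite /fibre_count setTI -sum1_card.
(* The fibre is split by the component of each vertex. The blocks have equal size by
   [fibre_count_le] in both directions. *)
rewrite (partition_big (@component_of X) (mem (components_over f y))) /=; last first.
  move=> x; rewrite inE => /eqP fx; have [CX xC] := component_ofP x.
  by rewrite inE CX card_gt0; apply/set0Pn; exists x; rewrite !inE fx xC eqxx.
rewrite -sum_nat_const; apply: eq_bigr => D DY.
have -> : #|C.1 :&: fibre f y| = #|D.1 :&: fibre f y|.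
  by apply/eqP; rewrite eqn_leq; apply/andP; split; apply: fibre_count_le.
rewrite sum1dep_card; apply: eq_card => x; rewrite !inE andbC; congr (_ && _).
have /andP[DX _] : (D \in components X) && (0 < fibre_count f D y).
  by move: DY; rewrite inE.
have [z zD] := component_inhabited DX.
by rewrite -(component_of_eq DX zD) mem_component.
Qed.

(** Double counting of pairs ([D], [i]) with [D] over [y i]: each component [D] of [X] lies over
    exactly one [y i]. *)
Lemma ncomponents_sum (X Y : graph) (f : X -> Y) (y : 'I_(ncomponents Y) -> Y) :
  complete_hom f -> orbit_hom f ->
  components Y = [set component_of (y i) | i : 'I_(ncomponents Y)] ->
  ncomponents X = \sum_(i < ncomponents Y) #|components_over f (y i)|.
Proof.
move=> cf of_ eY.
(* The [ncomponents Y] indices cover a set of that same size, so none of its elements is hit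
   twice. *)
have inj : injective (fun i => component_of (y i)).
  have inj : {in 'I_(ncomponents Y) &, injective (fun i => component_of (y i))}.
    by apply/imset_injP; rewrite card_ord -eY.
  by move=> i j; apply: inj.
have over i : #|components_over f (y i)|
    = \sum_(D in components X) (D \in components_over f (y i)).
  rewrite -sum1_card [RHS]big_mkcond /= big_mkcond /=; apply: eq_bigr => D _.
  by rewrite [D \in components_over _ _]inE; case: (D \in _) => //; case: (0 < _).
under eq_bigr do rewrite over.
rewrite exchange_big /= /ncomponents -sum1_card; apply: eq_bigr => D DX.
have [x xD] := component_inhabited DX; rewrite -(component_of_eq DX xD).
have [i ei] : exists i, component_of (f x) = component_of (y i).
  by have [] := component_ofP (f x); rewrite {1}eY => /imsetP[i _ ei]; exists i.
rewrite (bigD1 i) //= mem_components_over // ei eqxx big1 // => j ji.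
by rewrite mem_components_over // ei (inj_eq inj) (negPf ji).
Qed.

Theorem theoremB (X Y : graph) (phi : X -> Y)
    (phi_complete : complete_hom phi) (phi_orbit : orbit_hom phi)
    (y : 'I_(ncomponents Y) -> Y)
    (y_comp : components Y = [set component_of (y i) | i : 'I_(ncomponents Y)])
    (C : 'I_(ncomponents Y) -> subgraph X)
    (C_over : forall i, C i \in components_over phi (y i)) :
  ((ncomponents X)%:R : rat)%R =
    (\sum_(i < ncomponents Y)
       (fibre_count phi (full_subgraph X) (y i))%:R
         / (fibre_count phi (C i) (y i))%:R)%R.
Proof.
rewrite (ncomponents_sum phi_complete phi_orbit y_comp) GRing.natr_sum.
apply: eq_bigr => i _; rewrite (fibre_count_full phi_orbit (C_over i)).
(* The denominator is nonzero because [C i] meets the fibre over [y i], so the quotient is the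
   number of components over [y i]. *)
rewrite GRing.natrM GRing.mulfK // Num.Theory.pnatr_eq0 -lt0n.
by have := C_over i; rewrite inE => /andP[].
Qed.
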